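(* Let $(\mathcal F,\preceq)$ be an ordered system on the finite set $N$ with $\mathcal F=\{F_1,\dots,F_m\}$ indexed as below, let $f\in\mathbb R^N_+$, fix one run of the Monge algorithm on input $f$ with output $y\in\mathbb R^{\mathcal F}$, and for every valuation $v$ put $[f](v):=\sum_{F\in\mathcal F}y_Fv(F)$. Then the following are equivalent: (a) $[f](\zeta^i)=\int_{\mathcal F} f\,d\zeta^i$ for all $i=1,\dots,m$; (b) $[f](v)=\int_{\mathcal F} f\,dv$ for all valuations $v$ on $\mathcal F$.
   Context: An ordered system is a pair $(\mathcal F,\preceq)$ where $\mathcal F$ is a family of non-empty subsets of a finite set $N$ covering $N$, partially ordered by $\preceq$, indexed $\mathcal F=\{F_1,\dots,F_m\}$ so that $F_i\succeq F_j$ implies $i\le j$. A valuation is any $v:\mathcal F\to\mathbb R$. The simple functions $\zeta^i$ ($i=1,\dots,m$) are $\zeta^i(F)=1$ if $F\succeq F_i$, $0$ otherwise; they form a basis of the space of valuations. A belief function is $\sum_i\beta_i\zeta^i$ with all $\beta_i\ge0$. For a belief function $v$ and $f\in\mathbb R^N_+$: $\int_{\mathcal F} f\,dv:=\min\{\langle f,x\rangle\mid x\in\mathbb R^N_+,\ x(F)\ge v(F)\ \forall F\in\mathcal F\}$ ($x(F)=\sum_{i\in F}x_i$). For an arbitrary valuation $v=\sum_i\beta_i\zeta^i$ set $v^+=\sum_{\beta_i\ge0}\beta_i\zeta^i$, $v^-=\sum_{\beta_j\le0}(-\beta_j)\zeta^j$ and $\int_{\mathcal F} f\,dv:=\int_{\mathcal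 F} f\,dv^+-\int_{\mathcal F} f\,dv^-$. For $X\subseteq N$ let $\mathcal F(X)=\{F\in\mathcal F\mid F\subseteq X\}$. Monge algorithm on input $f$: initialize $X=N$, $c=f$, $y=0$; repeat: let $M=F_i$ be the member of $\mathcal F(X)$ of minimal index, choose $p\in M$ with $c_p=\min_{j\in M}c_j$, set $y_M:=c_p$, $c:=c-c_p\mathbf 1_M$, $X:=X\setminus\{p\}$; stop when $\mathcal F(X)=\emptyset$, output $y$. *)

(* Defs.v *)
From HB Require Import structures.
From mathcomp Require Import all_boot all_order all_algebra.
From mathcomp Require Import mathcomp_extra boolp classical_sets functions reals.
From mathcomp Require Import set_interval topology normedtype derive.

Set Implicit Arguments.
Unset Strict Implicit.
Unset Printing Implicit Defensive.

Import Order.TTheory GRing.Theory Num.Theory.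
Import numFieldNormedType.Exports.
Local Open Scope ring_scope.

(* The indices are shifted to start at 0. As [os_set] is injective, the order on
   the family is given on the indices, [os_le i j] standing for
   "os_set i precedes or equals os_set j". *)
Record ordered_system (N : finType) (m : nat) := OrderedSystem {
  os_set :> 'I_m -> {set N};
  os_inj : injective os_set;
  os_neq0 : forall i, os_set i != finset.set0;
  os_cover : \bigcup_i os_set i = finset.setT;
  os_le : rel 'I_m;
  os_le_refl : reflexive os_le;
  os_le_anti : antisymmetric os_le;
  os_le_trans : transitive os_le;
  os_le_index : forall i j : 'I_m, os_le j i -> (i <= j)%N
}.

(* [R^o] rather than [R], so that valuations form a [vectType R]. *)
Definition valuation (R : realType) (m : nat) := {ffun 'I_m -> R^o}.

Section Integral.
Context {R : realType} {N : finType} {m : nat} (F : ordered_system N m).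
Implicit Types (f x : {ffun N -> R}) (v : valuation R m).

Definition zeta (i : 'I_m) : valuation R m :=
  [ffun j => if os_le F i j then 1 else 0].

Definition zetas : m.-tuple (valuation R m) := [tuple zeta i | i < m].

(* Coefficients of v in the basis of simple functions, see [zetas_basis]. *)
Definition beta v (i : 'I_m) : R := coord zetas i v.

Definition is_belief v : Prop :=
  exists b : 'I_m -> R,
    (forall i, 0 <= b i) /\ v = \sum_(i < m) b i *: zeta i.

Definition feasible v x : Prop :=
  (forall p, 0 <= x p) /\ (forall i, v i <= \sum_(p in F i) x p).

Definition dotp f x : R := \sum_p f p * x p.

Definition is_minimum (A : set R) (a : R) : Prop := A a /\ lbound A a.

(* The minimum of A, or 0 when A has none. *)
Definition minimum (A : set R) : R := xget 0 (is_minimum A).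

Definition objective_values f v : set R :=
  [set a | exists x, feasible v x /\ a = dotp f x]%classic.

(* The integral of f >= 0 with respect to a belief function v; the minimum is
   attained, see [belief_integral_minimum]. *)
Definition belief_integral f v : R := minimum (objective_values f v).

Definition pos_part v : valuation R m :=
  \sum_(i < m | 0 <= beta v i) beta v i *: zeta i.

Definition neg_part v : valuation R m :=
  \sum_(i < m | beta v i <= 0) (- beta v i) *: zeta i.

(* Agrees with [belief_integral] on belief functions, see [integral_belief]. *)
Definition integral f v : R :=
  belief_integral f (pos_part v) - belief_integral f (neg_part v).

End Integral.

Section Monge.
Context {R : realType} {N : finType} {m : nat} (F : ordered_system N m).
Implicit Types (f c : {ffun N -> R}) (y : {ffun 'I_m -> R}) (X : {set N}).

(* [monge_from X c y z]: some execution of the loop started in the state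
   (X, c, y) stops with output z. The choice of p is nondeterministic. *)
Inductive monge_from :
    {set N} -> {ffun N -> R} -> {ffun 'I_m -> R} -> {ffun 'I_m -> R} -> Prop :=
| MongeStop X c y :
    (forall i, ~~ (F i \subset X)) -> monge_from X c y y
| MongeStep X c y z (i : 'I_m) (p : N) :
    F i \subset X -> (forall j : 'I_m, F j \subset X -> (i <= j)%N) ->
    p \in F i -> (forall q, q \in F i -> c p <= c q) ->
    monge_from (X :\ p)
      [ffun q => c q - c p * (q \in F i)%:R]
      [ffun j => if j == i then c p else y j] z ->
    monge_from X c y z.

Definition monge_output f y : Prop := monge_from finset.setT f 0 y.

Definition monge_value y (v : valuation R m) : R := \sum_(i < m) y i * v i.

End Monge.

Lemma continuous_sum_scale (R : realType) (T : topologicalType) (N : finType)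
    (h : N -> T -> R) (g : N -> R) (P : pred N) :
  (forall p, continuous (h p)) -> continuous (fun x => \sum_(p | P p) g p * h p x).
Proof.
move=> hc x; rewrite /continuous_at; elim: (index_enum N) => [|p s IH].
  by under eq_fun do rewrite big_nil; rewrite big_nil; exact: cvg_cst.
under eq_fun do rewrite big_cons; rewrite big_cons.
case: (P p) => //.
by apply: cvgD => //; apply: cvgM; [exact: cvg_cst | exact: hc].
Qed.

Section Facts.
Context {R : realType} {N : finType} {m : nat} (F : ordered_system N m).
Implicit Types (f x : {ffun N -> R}) (v : valuation R m).

Lemma zetas_nth (i : 'I_m) : (zetas F)`_i = zeta F i :> valuation R m.
Proof. by rewrite -tnth_nth tnth_mktuple. Qed.

Lemma zetas_free : free (zetas F : m.-tuple (valuation R m)).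
Proof.
apply/freeP => k k0.
suff kn0 n (j : 'I_m) : (m - j <= n)%N -> k j = 0 by move=> j; exact: kn0.
elim: n j => [|n IH] j; first by rewrite leqn0 subn_eq0 leqNgt ltn_ord.
move=> jn; have /ffunP/(_ j) := k0.
rewrite sum_ffunE ffunE (bigD1 j)//= big1 ?addr0.
  by rewrite ffunE zetas_nth ffunE os_le_refl => <-; rewrite [RHS]mulr1.
move=> i ij; rewrite ffunE zetas_nth ffunE.
case: ifPn => [le_ij|_]; last by rewrite scaler0.
have ji : (j < i)%N by rewrite ltn_neqAle eq_sym ij (os_le_index le_ij).
rewrite IH ?scale0r// -ltnS (leq_trans _ jn)// ltn_sub2l//.
Qed.

Lemma zetas_basis : basis_of fullv (zetas F : m.-tuple (valuation R m)).
Proof.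
rewrite basisEfree zetas_free subvf size_tuple dimvf /dim/=.
by rewrite card_ord muln1.
Qed.

Lemma belief_integral_minimum f v : (forall p, 0 <= f p) ->
  is_minimum (objective_values F f v) (belief_integral F f v).
Proof.
move=> f0; rewrite /belief_integral /minimum; apply: xgetPex.
pose T := prod_topology (fun _ : N => R).
pose K : R := \sum_(i < m) `|v i : R|.
have vK i : v i <= K.
  rewrite (le_trans (ler_norm _))// /K (bigD1 i)//= lerDl sumr_ge0//.
have K0 : 0 <= K by rewrite sumr_ge0.
pose box : set T := [set x | forall p, `[0, K]%classic (x p)]%classic.
pose feas : set T := [set x : T | forall i, v i <= \sum_(p in F i) x p]%classic.
have pc p : continuous (fun x : T => x p) by exact: proj_continuous.
have sc (g : N -> R) (P : pred N) :
    continuous (fun x : T => \sum_(p | P p) g p * x p).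
  exact: continuous_sum_scale.
have feasC : closed feas.
  have -> : feas = (\bigcap_(i in [set: 'I_m])
      (fun x : T => \sum_(p in F i) 1 * x p) @^-1` [set a | v i <= a])%classic.
    have E i (x : T) : \sum_(p in F i) 1 * x p = \sum_(p in F i) x p.
      by apply: eq_bigr => p _; rewrite mul1r.
    apply/seteqP; split => x /= xv j; first by rewrite /= E.
    by have := xv j I; rewrite /= E.
  apply: closed_bigI => i _; apply: preimage_closed; last exact: closed_ge.
  by move=> x _; exact: sc.
have boxC : compact box 
  by apply: (@tychonoff N (fun=> R) (fun=> `[0, K]%classic)) => p; exact: segment_compact.
have AC : compact (box `&` feas)%classic by exact: compact_closedI.
have A0 : (box `&` feas !=set0)%classic.
  exists (fun=> K); split => [p /=|i]; first by rewrite in_itv /= K0 lexx.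
  have /set0Pn [p pF] := os_neq0 F i.
  rewrite (le_trans (vK i))// (bigD1 p)//= lerDl sumr_ge0//.
have [|x xA xmin] := @compact_EVT_min T R
  (fun x : T => \sum_(p : N) f p * x p) _ A0 AC.
  apply: continuous_subspaceT; exact: sc.
move: xA; rewrite inE => -[xbox xfeas].
have x0 p : 0 <= x p by have := xbox p; rewrite /= in_itv/= => /andP[].
exists (\sum_p f p * x p); split.
  exists [ffun p => x p]; split; last first.
    by apply: eq_bigr => p _; rewrite ffunE.
  split=> [p|i]; first by rewrite ffunE.
  by under eq_bigr => p _ do rewrite ffunE; exact: xfeas.
move=> _ [z [[z0 zv] ->]].
have := xmin (fun p => Num.min (z p) K); rewrite inE => le.
apply: (le_trans (le _)); last first.
  by apply: ler_sum => p _; rewrite ler_wpM2l// ge_min lexx.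
split => [p /=|i]; first by rewrite in_itv /= le_min z0 K0 ge_min lexx orbT.
have min0 p : 0 <= Num.min (z p) K by rewrite le_min z0.
have [/existsP[p /andP[pF Kz]]|/existsPn nK] :=
    boolP [exists p, (p \in F i) && (K <= z p)].
  rewrite (le_trans (vK i))// (bigD1 p)//= min_r// lerDl sumr_ge0// => q _.
rewrite (le_trans (zv i))//; apply: ler_sum => p pF.
by have := nK p; rewrite pF -ltNge => /ltW zK; rewrite min_l.
Qed.

Lemma integral_belief f v : (forall p, 0 <= f p) -> is_belief F v ->
  integral F f v = belief_integral F f v.
Proof.
move=> f0 [b [b0 vE]].
have bE i : beta F v i = b i.
  rewrite /beta; have -> : v = \sum_(i < m) b i *: (zetas F)`_i.
    by rewrite vE; apply: eq_bigr => j _; rewrite zetas_nth.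
  by rewrite coord_sum_free// zetas_free.
rewrite /integral.
have -> : pos_part F v = v.
  rewrite [RHS]vE /pos_part; apply: eq_big => i; first by rewrite bE b0.
  by rewrite bE.
have -> : neg_part F v = 0.
  rewrite /neg_part big1// => i; rewrite bE => bi.
  by rewrite [b i](_ : _ = 0) ?oppr0 ?scale0r//; apply/eqP; rewrite eq_le bi b0.
have [[x [[x0 _] E]] lb] := belief_integral_minimum 0 f0.
suff -> : belief_integral F f 0 = 0 by rewrite subr0.
apply/eqP; rewrite eq_le; apply/andP; split; last first.
  by rewrite E sumr_ge0// => p _; rewrite mulr_ge0.
apply: lb; exists 0; split; last first.
  by rewrite /dotp big1// => p _; rewrite ffunE mulr0.
split=> [p|i]; first by rewrite ffunE.
by rewrite ffunE big1// => p _; rewrite ffunE.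
Qed.
End Facts.

(* Main.v *)
Require Import Defs.
From mathcomp Require Import all_boot all_order all_algebra.
From mathcomp Require Import reals.
Import Order.TTheory GRing.Theory Num.Theory.
Local Open Scope ring_scope.

(** The Monge output [y] is a feasible solution of the linear program dual to
    the one defining the integral, so weak duality bounds [f](v) by the integral
    of every valuation [v]. Conversely the integral is sublinear, so if it agrees
    with [f] on the simple functions it is at most [f](v) on their nonnegative
    combinations. Hence both agree on belief functions, and then on all
    valuations by linearity of [f] and [v = v^+ - v^-]. *)

Section BeliefIntegral.
Context {R : realType} {N : finType} {m : nat} (F : ordered_system N m).
Variable (f : {ffun N -> R}).
Hypothesis f_ge0 : forall p, 0 <= f p.
Implicit Types (u v w : valuation R m) (b : 'I_m -> R).

Lemma belief_integral0_le0 : belief_integral F f 0 <= 0.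
Proof.
have [_ lb] := @belief_integral_minimum R N m F f 0 f_ge0.
apply: lb; exists 0; split; last first.
  by rewrite /dotp big1 // => p _; rewrite ffunE mulr0.
split=> [p|i]; first by rewrite ffunE.
by rewrite ffunE big1 // => p _; rewrite ffunE.
Qed.

(** If [x] and [z] are optimal for [u] and [w], then [a * x + z] is feasible for [a *: u + w], since
    [0 <= a] preserves the constraints. *)
Lemma belief_integral_sublinear (a : R) u w : 0 <= a ->
  belief_integral F f (a *: u + w) <=
  a * belief_integral F f u + belief_integral F f w.
Proof.
move=> a0.
have [[x [[x0 xu] ->]] _] := @belief_integral_minimum R N m F f u f_ge0.
have [[z [[z0 zw] ->]] _] := @belief_integral_minimum R N m F f w f_ge0.
have [_ lb] := @belief_integral_minimum R N m F f (a *: u + w) f_ge0.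
apply: lb; exists [ffun p => a * x p + z p]; split; last first.
  rewrite /dotp mulr_sumr -big_split; apply: eq_bigr => p _ /=.
  by rewrite ffunE mulrDr mulrCA.
split=> [p|i]; first by rewrite ffunE addr_ge0 // mulr_ge0.
rewrite !ffunE; under eq_bigr do rewrite ffunE.
by rewrite big_split -mulr_sumr; apply: lerD => //; apply: ler_wpM2l.
Qed.

Lemma belief_integral_conic_le (P : pred 'I_m) b :
  (forall i, P i -> 0 <= b i) ->
  belief_integral F f (\sum_(i < m | P i) b i *: zeta F i) <=
  \sum_(i < m | P i) b i * belief_integral F f (zeta F i).
Proof.
move=> b0.
apply: (big_rec2 (fun (v : valuation R m) (r : R) => belief_integral F f v <= r)).
  exact: belief_integral0_le0.
move=> i r v Pi vr; apply: (le_trans (@belief_integral_sublinear _ _ _ (b0 i Pi))).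
by rewrite lerD2l.
Qed.

End BeliefIntegral.

Section MongeValue.
Context {R : realType} {N : finType} {m : nat} (F : ordered_system N m).
Implicit Types (f : {ffun N -> R}) (y : {ffun 'I_m -> R}) (v w : valuation R m).

Lemma monge_valueB y v w :
  monge_value y (v - w) = monge_value y v - monge_value y w.
Proof.
rewrite /monge_value -sumrB; apply: eq_bigr => i _.
by rewrite !ffunE mulrBr.
Qed.

Lemma monge_value_sum y (P : pred 'I_m) (b : 'I_m -> R) (u : 'I_m -> valuation R m) :
  monge_value y (\sum_(i < m | P i) b i *: u i) =
  \sum_(i < m | P i) b i * monge_value y (u i).
Proof.
rewrite /monge_value.
under [RHS]eq_bigr do rewrite mulr_sumr.
rewrite exchange_big; apply: eq_bigr => j _ /=.
rewrite sum_ffunE mulr_sumr; apply: eq_bigr => i _.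
by rewrite ffunE mulrCA.
Qed.

(** The constraints of the dual program. The valuation enters only the dual objective
    [monge_value y v], so one [y] serves every [v]. *)
Definition dual_feasible f y : Prop :=
  (forall i, 0 <= y i) /\
  (forall p, \sum_(i < m) y i * (p \in F i)%:R <= f p).

(** Loop invariant: [c] is the slack left in the dual constraints and stays nonnegative, while [y]
    is still zero on every set inside [X]. *)
Lemma monge_from_dual_feasible f X c y z :
  monge_from F X c y z ->
  (forall p, 0 <= c p) -> (forall i, 0 <= y i) ->
  (forall i, F i \subset X -> y i = 0) ->
  (forall p, c p + \sum_(i < m) y i * (p \in F i)%:R = f p) ->
  dual_feasible f z.
Proof.
elim=> {X c y z} [X c y _|X c y z i p iX _ pi cmin _ IH] c0 y0 yX cf.
  by split=> // p; rewrite -cf lerDr.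
apply: IH => [q|j|j jX|q].
- rewrite ffunE; case: (boolP (q \in F i)) => qi; last by rewrite mulr0 subr0.
  by rewrite mulr1 subr_ge0 cmin.
- by rewrite ffunE; case: ifP.
(* The set just assigned contains [p], so it is not inside [X :\ p]. *)
- rewrite ffunE; case: eqP => [ji|_].
    by move/subsetP/(_ p): jX; rewrite ji pi !inE eqxx => /(_ isT).
  by apply: yX; apply: (subset_trans jX); exact: subD1set.
(* As [y i] was zero, assigning it [c p] adds to the sum exactly what [c] loses on [F i]. *)
- rewrite -(cf q) !ffunE (bigD1 i) //= [in RHS](bigD1 i) //= ffunE eqxx.
  rewrite (yX i iX) mul0r add0r addrA subrK; congr (_ + _).
  by apply: eq_bigr => j /negPf ji; rewrite ffunE ji.
Qed.

Lemma monge_output_dual_feasible f y : (forall p, 0 <= f p) ->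
  monge_output F f y -> dual_feasible f y.
Proof.
move=> f0 /monge_from_dual_feasible; apply=> // [i|i _|p]; rewrite ?ffunE //.
by rewrite big1 ?addr0 // => i _; rewrite ffunE mul0r.
Qed.

(** Weak duality: for an optimal [x], exchange the sums in the total of [y i * x p] over all
    [p \in F i]. *)
Lemma dual_feasible_le_belief_integral f y v : (forall p, 0 <= f p) ->
  dual_feasible f y -> monge_value y v <= belief_integral F f v.
Proof.
move=> f0 [y0 yf].
have [[x [[x0 xv] ->]] _] := @belief_integral_minimum R N m F f v f0.
apply: (@le_trans _ _ (\sum_(i < m) y i * \sum_(p in F i) x p)).
  by apply: ler_sum => i _; apply: ler_wpM2l.
under eq_bigr do rewrite mulr_sumr big_mkcond.
rewrite exchange_big; apply: ler_sum => p _ /=.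
apply: le_trans (ler_wpM2r (x0 p) (yf p)).
rewrite mulr_suml; apply: ler_sum => i _.
by case: (p \in F i); rewrite ?mulr1 // mulr0 mul0r.
Qed.

Lemma pos_partB_neg_part v : pos_part F v - neg_part F v = v.
Proof.
rewrite [RHS](coord_basis (zetas_basis F) (memvf v)).
rewrite /pos_part /neg_part -sumrN big_mkcond [X in _ + X]big_mkcond -big_split /=.
apply: eq_bigr => i _; rewrite zetas_nth -/(beta F v i) scaleNr opprK.
(* A zero coefficient is indexed in both parts, where its terms vanish. *)
by case: ltgtP => [||<-]; rewrite ?addr0 ?add0r ?scale0r ?addr0.
Qed.

End MongeValue.

Theorem theorem1 (R : realType) (N : finType) (m : nat)
    (F : ordered_system N m) (f : {ffun N -> R}) (f_ge0 : forall p, 0 <= f p)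
    (y : {ffun 'I_m -> R}) (y_out : monge_output F f y) :
  (forall i : 'I_m, monge_value y (zeta F i) = integral F f (zeta F i)) <->
  (forall v : valuation R m, monge_value y v = integral F f v).
Proof.
split=> [eq_zeta v|eq_val i]; last exact: eq_val.
have y_dual := @monge_output_dual_feasible _ _ _ F f y f_ge0 y_out.
have zeta_belief i : is_belief F (zeta F i : valuation R m).
  exists (fun j => (j == i)%:R); split=> [j|]; first exact: ler0n.
  rewrite (bigD1 i) //= eqxx scale1r big1 ?addr0 // => j /negPf ->.
  by rewrite scale0r.
have conicE (P : pred 'I_m) (b : 'I_m -> R) : (forall i, P i -> 0 <= b i) ->
    monge_value y (\sum_(i < m | P i) b i *: zeta F i) =
    belief_integral F f (\sum_(i < m | P i) b i *: zeta F i).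
  (* Weak duality gives one inequality, sublinearity the other. *)
  move=> b0; apply/eqP; rewrite eq_le dual_feasible_le_belief_integral //=.
  rewrite monge_value_sum (le_trans (@belief_integral_conic_le _ _ _ F f f_ge0 P b b0)) //.
  (* The hypothesis speaks of [integral], which is [belief_integral] on the belief function
     [zeta F i]. *)
  by apply: ler_sum => i _; rewrite eq_zeta integral_belief.
rewrite -{1}(@pos_partB_neg_part _ _ _ F v) monge_valueB /integral /pos_part /neg_part.
by rewrite !conicE // => i; rewrite oppr_ge0.
Qed.
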